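(* Let $K_{n_1,n_2}$ be the complete bipartite graph with parts of sizes $n_1$ and $n_2$, where $1\le n_1\le n_2$, and let $h$ be an integer with $1\le h\le \rho(K_{n_1,n_2})$, where $\rho(K_{n_1,n_2})=2n_1-1$ if $n_1=n_2$ and $\rho(K_{n_1,n_2})=2n_1$ if $n_1\ne n_2$. Then the number of paths with length $h$ in $K_{n_1,n_2}$ is $$P_h(K_{n_1,n_2})=\begin{cases}\displaystyle \frac12\Big(\prod_{i=0}^{\frac h2-1}(n_1-i)(n_2-i)\Big)\Big(\big(n_1-\tfrac h2\big)+\big(n_2-\tfrac h2\big)\Big), & h \text{ even},\\[2ex] \displaystyle \prod_{i=0}^{\frac{h-1}{2}}(n_1-i)(n_2-i), & h\text{ odd}.\end{cases}$$
   Context: Graphs are finite and simple. A path of length $h$ in $G$ is a subgraph that is a path with $h$ edges ($h+1$ distinct vertices); paths are undirected, so a vertex sequence and its reversal are the same path. $P_h(G)$ is the number of paths of length $h$ in $G$, and $\rho(G)$ is the length of a longest path in $G$. *)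

(* Defs.v *)
From mathcomp Require Import all_boot.

Set Implicit Arguments.
Unset Strict Implicit.
Unset Printing Implicit Defensive.

Record sgraph := SGraph {
  vertex :> finType;
  adj : rel vertex;
  adj_sym : symmetric adj;
  adj_irrefl : irreflexive adj
}.

(* A candidate subgraph is a pair (V, E) of a vertex set and a set of edges,
   an edge being the unordered pair [set x; y] of its two ends. *)
Definition subgraph (G : sgraph) : finType := ({set G} * {set {set G}})%type.

Definition is_subgraph (G : sgraph) (H : subgraph G) : bool :=
  [forall e in H.2, exists x in H.1, exists y in H.1,
     adj x y && (e == [set x; y])].

Definition path_vertices (G : sgraph) (h : nat) (p : h.+1.-tuple G) : {set G} :=
  [set x in p].

Definition path_edges (G : sgraph) (h : nat) (p : h.+1.-tuple G) :
    {set {set G}} :=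
  [set [set tnth p (widen_ord (leqnSn h) i); tnth p (lift ord0 i)] | i : 'I_h].

Definition is_path_graph (G : sgraph) (h : nat) (H : subgraph G) : bool :=
  [exists p : h.+1.-tuple G,
     [&& uniq p, H.1 == path_vertices p & H.2 == path_edges p]].

(* Paths are counted as subgraphs, so a vertex sequence and its reversal
   contribute only once. *)
Definition num_paths (G : sgraph) (h : nat) : nat :=
  #|[set H : subgraph G | is_subgraph H && is_path_graph h H]|.

(* The bound h < #|G| loses nothing: a path of length h has h + 1 distinct
   vertices. *)
Definition longest_path (G : sgraph) : nat :=
  \max_(h < #|G| | 0 < num_paths G h) h.

Definition is_left (A B : Type) (x : A + B) : bool :=
  if x is inl _ then true else false.

Definition Kbip_adj (n1 n2 : nat) : rel ('I_n1 + 'I_n2)%type :=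
  fun x y => is_left x != is_left y.

Lemma Kbip_sym (n1 n2 : nat) : symmetric (@Kbip_adj n1 n2).
Proof. by move=> x y; rewrite /Kbip_adj eq_sym. Qed.

Lemma Kbip_irrefl (n1 n2 : nat) : irreflexive (@Kbip_adj n1 n2).
Proof. by move=> x; rewrite /Kbip_adj eqxx. Qed.

Definition Kbip (n1 n2 : nat) : sgraph :=
  SGraph (@Kbip_sym n1 n2) (@Kbip_irrefl n1 n2).

(* Main.v *)
Require Import Defs.
From mathcomp Require Import all_boot all_order all_algebra.
From mathcomp Require Import zify ring.

Import GRing.Theory.

(* Stdlib's sumbool projection shadows the side predicate of [Defs]. *)
Local Notation is_left := Defs.is_left.

(** Every path with at least one edge is traced by exactly two vertex
    sequences, one the reversal of the other: the positions in one tracing of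
    the vertices of another form an injective walk with steps +1 and -1 on
    {0, ..., h}, which can never turn back.  In a complete bipartite graph the
    vertex sequences are the alternating ones without repetition; they are
    counted by prepending vertices one at a time, a sequence of k vertices
    whose head lies on one side having k./2 vertices on the other side. *)

(** * Vertex sequences tracing a path *)

Definition path_seq (G : sgraph) (s : seq G) : bool := uniq s && sorted (@adj G) s.

Definition traced_subgraph {G : sgraph} {h : nat} (p : h.+1.-tuple G) :
    subgraph G :=
  (path_vertices p, path_edges p).

Lemma eq_set2 (T : finType) (a b x y : T) :
  [set a; b] = [set x; y] -> (a = x /\ b = y) \/ (a = y /\ b = x).
Proof.
move=> /setP E.
have := E a; have := E b; have := E x; have := E y.
rewrite !inE !eqxx ?orbT /= => /orP ya_or_yb /orP xa_or_xb.
move=> /esym /orP bx_or_by /esym /orP ax_or_ay.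
case: ax_or_ay => /eqP; case: bx_or_by => /eqP;
  case: ya_or_yb => /eqP; case: xa_or_xb => /eqP; intuition congruence.
Qed.

Lemma path_edgesP (G : sgraph) (h : nat) (p : h.+1.-tuple G) (x0 : G)
    (e : {set G}) :
  reflect (exists2 i, i < h & e = [set nth x0 p i; nth x0 p i.+1])
          (e \in path_edges p).
Proof.
have tnthE (i : 'I_h) :
    [set tnth p (widen_ord (leqnSn h) i); tnth p (lift ord0 i)] =
    [set nth x0 p i; nth x0 p i.+1].
  by rewrite !(tnth_nth x0).
apply: (iffP imsetP) => [[i _ ->]|[i lt_ih ->]].
  by exists (nat_of_ord i) => //; exact: tnthE.
by exists (Ordinal lt_ih) => //; rewrite [RHS](tnthE (Ordinal lt_ih)).
Qed.

(** Both ends of a traced edge are traced vertices by construction, so only adjacency of consecutive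
    vertices remains to be tested. *)
Lemma is_subgraph_traced (G : sgraph) (h : nat) (p : h.+1.-tuple G) :
  is_subgraph (traced_subgraph p) = sorted (@adj G) p.
Proof.
pose x0 := thead p.
apply/forall_inP/(sortedP x0) => [sub i | adj_p e].
  rewrite size_tuple ltnS => lt_ih.
  have /sub/exists_inP[x _ /exists_inP[y _ /andP[xy /eqP/eq_set2]]] :
      [set nth x0 p i; nth x0 p i.+1] \in (traced_subgraph p).2.
    by apply/(path_edgesP _ _ p x0); exists i.
  by case=> -[-> ->] //; rewrite adj_sym.
move=> /(path_edgesP _ _ p x0)[i lt_ih ->].
have mem_p j : j <= h -> nth x0 p j \in (traced_subgraph p).1.
  by move=> le_jh; rewrite inE mem_nth // size_tuple ltnS.
apply/exists_inP; exists (nth x0 p i); first exact/mem_p/ltnW.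
apply/exists_inP; exists (nth x0 p i.+1); first exact: mem_p.
by rewrite adj_p ?size_tuple //=.
Qed.

Lemma traced_subgraph_rev (G : sgraph) (h : nat) (p : h.+1.-tuple G) :
  traced_subgraph (rev_tuple p) = traced_subgraph p.
Proof.
congr pair; first by apply/setP=> x; rewrite !inE mem_rev.
have sub (q : h.+1.-tuple G) :
    path_edges (rev_tuple q) \subset path_edges q.
  pose x0 := thead q.
  apply/subsetP=> e /(path_edgesP _ _ _ x0)[i lt_ih ->].
  (* Reversal sends positions [i] and [i.+1] to [h - i] and [h - i.+1]; the edge is indexed by the
     smaller one. *)
  apply/(path_edgesP _ _ _ x0); exists (h - i.+1); first by lia.
  rewrite /= !nth_rev ?size_tuple; try lia.
  by rewrite setUC !subSS (subnSK lt_ih).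
apply/eqP; rewrite eqEsubset sub /=.
have rev_rev : rev_tuple (rev_tuple p) = p by apply: val_inj; rewrite /= revK.
by rewrite -{1}rev_rev sub.
Qed.

Lemma path_seq_rev (G : sgraph) (s : seq G) : path_seq G (rev s) = path_seq G s.
Proof.
rewrite /path_seq rev_uniq rev_sorted; congr (_ && _).
by apply: eq_sorted => x y; exact: adj_sym.
Qed.

(** The first step fixes the direction, since turning later would give [f i.+2 = f i] against
    injectivity. With [h] steps in one direction the walk must start at an end. *)
Lemma injective_walk (h : nat) (f : nat -> nat) :
  (forall i, i <= h -> f i <= h) ->
  (forall i j, i <= h -> j <= h -> f i = f j -> i = j) ->
  (forall i, i < h -> f i.+1 = (f i).+1 \/ f i = (f i.+1).+1) ->
  (forall i, i <= h -> f i = i) \/ (forall i, i <= h -> f i = h - i).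
Proof.
move=> f_le f_inj f_step.
case: h => [|h] in f_le f_inj f_step *.
  by left=> i; have := f_le 0 isT; rewrite !leqn0 => /eqP f0 /eqP ->.
have [up|down] := f_step 0 isT; [left | right].
  have E i : i <= h -> f i = f 0 + i /\ f i.+1 = f 0 + i.+1.
    elim: i => [|i IH] lt_ih; first by lia.
    have [E1 E2] := IH (ltnW lt_ih); split=> //.
    have [|back] := f_step i.+1 lt_ih; first by lia.
    by have := f_inj i i.+2 ltac:(lia) ltac:(lia) ltac:(lia); lia.
  (* Here [f 0 + h.+1 <= h.+1] forces [f 0 = 0]. *)
  have := f_le h.+1 (leqnn _); have [_ Eh] := E h (leqnn h).
  by move=> ? [|i] le_ih; [lia | have := E i le_ih; lia].
have E i : i <= h -> f i + i = f 0 /\ f i.+1 + i.+1 = f 0.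
  elim: i => [|i IH] lt_ih; first by lia.
  have [E1 E2] := IH (ltnW lt_ih); split=> //.
  have [back|] := f_step i.+1 lt_ih; last by lia.
  by have := f_inj i i.+2 ltac:(lia) ltac:(lia) ltac:(lia); lia.
(* Here [f h.+1 + h.+1 = f 0 <= h.+1] forces [f 0 = h.+1]. *)
have := f_le 0 isT; have [_ Eh] := E h (leqnn h).
by move=> ? [|i] le_ih; [lia | have := E i le_ih; lia].
Qed.

(** Let [f i] be the position in [p] of the [i]-th vertex of [q]. Equal vertex sets keep [f] within
    range, equal edge sets make its steps +1 or -1, and [injective_walk] applies. *)
Lemma traced_subgraph_eq (G : sgraph) (h : nat) (p q : h.+1.-tuple G) :
  uniq p -> uniq q -> traced_subgraph q = traced_subgraph p ->
  q = p \/ q = rev_tuple p.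
Proof.
move=> Up Uq [eqV eqE].
pose x0 := thead p; pose f i := index (nth x0 q i) p.
have mem_p i : i <= h -> nth x0 q i \in p.
  move=> le_ih; have /setP/(_ (nth x0 q i)) := eqV.
  by rewrite !inE mem_nth ?size_tuple.
have nth_f i : i <= h -> nth x0 p (f i) = nth x0 q i.
  by move=> le_ih; rewrite nth_index ?mem_p.
have f_le i : i <= h -> f i <= h.
  by move=> le_ih; have := mem_p i le_ih; rewrite -index_mem size_tuple ltnS.
have f_inj i j : i <= h -> j <= h -> f i = f j -> i = j.
  move=> le_ih le_jh eq_f; apply/eqP.
  rewrite -(nth_uniq x0 _ _ Uq) ?size_tuple //.
  by rewrite -!nth_f // eq_f.
have f_step i : i < h -> f i.+1 = (f i).+1 \/ f i = (f i.+1).+1.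
  move=> lt_ih.
  have : [set nth x0 q i; nth x0 q i.+1] \in path_edges q.
    by apply/(path_edgesP _ _ _ x0); exists i.
  rewrite eqE => /(path_edgesP _ _ _ x0)[j lt_jh /eq_set2].
  rewrite /f => -[] [-> ->]; rewrite !index_uniq ?size_tuple //; try lia;
    by [left | right].
have [E|E] := injective_walk h f f_le f_inj f_step; [left | right];
  apply/val_inj/(@eq_from_nth _ x0); rewrite ?size_rev ?size_tuple // => i;
  rewrite ltnS => le_ih.
- by rewrite -nth_f // E.
- by rewrite -nth_f // E //= nth_rev ?size_tuple // subSS.
Qed.

(** The two ends sit at positions [0] and [h], which differ once [h] is positive; a path of length 0
    has a single tracing. *)
Lemma rev_path_neq (G : sgraph) (h : nat) (p : h.+1.-tuple G) :
  0 < h -> uniq p -> p != rev_tuple p.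
Proof.
move=> h_gt0 Up; apply/eqP => /(congr1 val) /= eq_p.
pose x0 := thead p.
have := congr1 (fun s => nth x0 s 0) eq_p.
rewrite nth_rev ?size_tuple // subn1 /= => /eqP.
by rewrite nth_uniq ?size_tuple //; lia.
Qed.

(** The path subgraphs are the image of the path sequences under [traced_subgraph], and each fibre
    is a sequence with its reversal. *)
Lemma card_path_tuples (G : sgraph) (h : nat) : 0 < h ->
  #|[set p : h.+1.-tuple G | path_seq G p]| = 2 * num_paths G h.
Proof.
move=> h_gt0; rewrite /num_paths.
have -> : [set H : subgraph G | is_subgraph H && is_path_graph h H] =
    traced_subgraph @: [set p : h.+1.-tuple G | path_seq G p].
  apply/setP=> H; rewrite inE; apply/andP/imsetP.
    move=> [subH /existsP[p /and3P[Up /eqP H1 /eqP H2]]].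
    have eqH : H = traced_subgraph p by case: H H1 H2 {subH} => V E /= -> ->.
    by exists p; rewrite // inE /path_seq Up -is_subgraph_traced -eqH.
  move=> [p]; rewrite inE => /andP[Up path_p] ->.
  rewrite is_subgraph_traced; split=> //.
  by apply/existsP; exists p; rewrite Up !eqxx.
rewrite -sum1_card (partition_big_imset traced_subgraph) /= mulnC -sum_nat_const.
apply: eq_bigr => H /imsetP[p]; rewrite inE => path_p ->.
have Up : uniq p by case/andP: path_p.
rewrite sum1dep_card.
have := rev_path_neq _ _ p h_gt0 Up.
set r := rev_tuple p => neq_pr.
suff -> : [set q | (q \in [set p : h.+1.-tuple G | path_seq G p]) &&
                 (traced_subgraph q == traced_subgraph p)] = [set p; r].
  by rewrite !cards2 neq_pr.
apply/setP=> q; rewrite !inE; apply/andP/orP.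
  move=> [/andP[Uq _] /eqP /(traced_subgraph_eq _ _ _ _ Up Uq)].
  by case=> ->; rewrite eqxx; [left | right].
case=> /eqP ->; first by rewrite path_p.
by rewrite traced_subgraph_rev /= path_seq_rev.
Qed.

(** * Alternating sequences without repetition *)

Fixpoint alternating (A B : Type) (b : bool) (s : seq (A + B)) : bool :=
  if s is x :: s' then (is_left x == b) && alternating A B (~~ b) s' else true.

(** A nonempty sequence cannot start on both sides, so exclusive or expresses the disjunction, in a
    form that case analysis on sides settles. *)
Lemma sorted_Kbip_adj (n1 n2 : nat) (s : seq ('I_n1 + 'I_n2)) : 0 < size s ->
  sorted (@Kbip_adj n1 n2) s =
  alternating _ _ true s (+) alternating _ _ false s.
Proof.
case: s => // x s _ /=.
elim: s x => [|y s IH] x /=; first by case: is_left.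
rewrite IH /Kbip_adj.
by case: (is_left x); case: (is_left y); rewrite //= ?addbF ?andbF ?addbC.
Qed.

Lemma not_alternating_both (A B : Type) (s : seq (A + B)) : 0 < size s ->
  ~~ (alternating _ _ true s && alternating _ _ false s).
Proof. by case: s => // -[a | b] s _ //=; rewrite andbF. Qed.

Lemma count_alternating (A B : Type) (b : bool) (s : seq (A + B)) :
  alternating _ _ b s ->
  count (fun x => is_left x == b) s = uphalf (size s) /\
  count (fun x => is_left x == ~~ b) s = (size s)./2.
Proof.
elim: s b => [|x s IH] b //= /andP[/eqP -> /IH []].
by rewrite negbK eqxx => -> ->; case: b => /=.
Qed.

Lemma card_side (n1 n2 : nat) (b : bool) :
  #|[pred x : 'I_n1 + 'I_n2 | is_left x == b]| = if b then n1 else n2.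
Proof.
rewrite -sum1_card big_sumType /=.
by case: b => /=; rewrite big_pred0_eq ?addn0 ?add0n sum1_card card_ord.
Qed.

Lemma card_tuple_cons (T : finType) (k : nat) (P : pred (seq T)) :
  #|[set p : k.+1.-tuple T | P p]| =
  \sum_(t : k.-tuple T) #|[pred x | P (x :: t)]|.
Proof.
rewrite -sum1dep_card (reindex (fun u : T * k.-tuple T => cons_tuple u.1 u.2)) /=.
  under [RHS]eq_bigr => t _ do rewrite -sum1_card.
  rewrite (exchange_big_dep predT) //= pair_big_dep /=.
  by apply: eq_bigl => -[x t].
exists (fun p : k.+1.-tuple T => (thead p, [tuple of behead p])).
  by move=> [x t] _; congr pair; apply: val_inj.
by move=> p _; rewrite [RHS]tuple_eta; apply: val_inj.
Qed.

Lemma card_alternating_tuples (n1 n2 k : nat) (b : bool) :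
  #|[set p : k.-tuple ('I_n1 + 'I_n2) | uniq p && alternating _ _ b p]| =
  (if b then n1 else n2) ^_ (uphalf k) * (if b then n2 else n1) ^_ k./2.
Proof.
elim: k b => [|k IH] b.
  rewrite !ffactn0 -[RHS](expn0 #|{: 'I_n1 + 'I_n2}|) -card_tuple -cardsT.
  by apply: eq_card => p; rewrite !inE tuple0.
rewrite (card_tuple_cons _ _ (fun s => uniq s && alternating _ _ b s)).
pose N := if b then n1 else n2.
(* A valid tail starts on side [~~ b], so [k./2] of its vertices lie on side [b]; the new head is
   any of the other vertices of side [b]. *)
transitivity (\sum_(t in [set p : k.-tuple ('I_n1 + 'I_n2) |
                          uniq p && alternating _ _ (~~ b) p]) (N - k./2)).
  rewrite [RHS]big_mkcond /=; apply: eq_bigr => t _; rewrite inE.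
  have [/andP[Ut alt_t]|bad] := ifP; last first.
    apply: eq_card0 => x; rewrite !inE /=.
    by move: bad; case: (uniq t); rewrite ?andbF //= => ->; rewrite !andbF.
  have [_] := count_alternating _ _ _ _ alt_t.
  rewrite negbK size_tuple => <-.
  rewrite -[N](card_side n1 n2 b) -size_filter -(card_uniqP _); last first.
    exact: filter_uniq.
  (* Side [b] splits into the vertices already in [t] and the admissible heads. *)
  rewrite -(cardID [in t] [pred x | is_left x == b]).
  have /eq_card -> : [seq x <- t | is_left x == b] =i
      [predI [pred x | is_left x == b] & in_mem^~ (mem t)].
    by move=> x; rewrite !inE mem_filter.
  rewrite addKn; apply: eq_card => x.
  by rewrite !inE /= Ut alt_t !andbT.
rewrite sum_nat_const IH uphalfE /= -/(k./2) /N.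
case: b {N} => /=; rewrite ffactnSr; ring.
Qed.

(** * Path counts and longest paths in the complete bipartite graph *)

Lemma two_num_paths_Kbip (n1 n2 h : nat) : 0 < h ->
  2 * num_paths (Kbip n1 n2) h =
  n1 ^_ h./2.+1 * n2 ^_ (uphalf h) + n2 ^_ h./2.+1 * n1 ^_ (uphalf h).
Proof.
move=> h_gt0; rewrite -card_path_tuples //.
have := card_alternating_tuples n1 n2 h.+1.
rewrite uphalfE /= => cards; rewrite -(cards true) -(cards false).
(* The two summands count tracings starting on the left and on the right; the sum of their sizes is
   that of the union because the intersection is empty. *)
rewrite -cardsUI [X in _ + X](_ : _ = 0) ?addn0.
  apply: eq_card => p; rewrite !inE /path_seq.
  have p0 : 0 < size p by rewrite size_tuple.
  rewrite -andb_orr (sorted_Kbip_adj n1 n2) //.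
  by have := not_alternating_both _ _ _ p0; do 2 case: alternating.
apply: eq_card0 => p; rewrite !inE andbACA andbb.
have p0 : 0 < size p by rewrite size_tuple.
by rewrite (negbTE (not_alternating_both _ _ _ p0)) andbF.
Qed.

(** The count of tracings starting in the part of size [n2] is positive whenever the other count is,
    so it alone decides. *)
Lemma num_paths_Kbip_gt0 (n1 n2 h : nat) : n1 <= n2 -> 0 < h ->
  (0 < num_paths (Kbip n1 n2) h) = (h./2 < n2) && (uphalf h <= n1).
Proof.
move=> le_n12 h_gt0.
have -> : (0 < num_paths (Kbip n1 n2) h) = (0 < 2 * num_paths (Kbip n1 n2) h).
  by rewrite muln_gt0.
rewrite two_num_paths_Kbip // addn_gt0 !muln_gt0 !ffact_gt0.
have := uphalf_half h; lia.
Qed.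

Lemma longest_path_Kbip (n1 n2 : nat) : 0 < n1 -> n1 <= n2 ->
  longest_path (Kbip n1 n2) = if n1 == n2 then 2 * n1 - 1 else 2 * n1.
Proof.
move=> n1_gt0 le_n12; set L := RHS.
have card_K : #|Kbip n1 n2| = n1 + n2 by rewrite card_sum !card_ord.
(* The maximum in [longest_path] ranges below the number of vertices, so [L] must be an admissible
   index. *)
have L_lt : L < #|Kbip n1 n2| by rewrite card_K /L; case: eqP; lia.
have L_gt0 : 0 < L by rewrite /L; case: eqP; lia.
apply/eqP; rewrite eqn_leq; apply/andP; split.
  (* The condition on [n1] bounds the length by [2 * n1]; when [n1 = n2], the strict condition on
     [n2] excludes [2 * n1] itself. *)
  apply/bigmax_leqP => -[[|h] lt_h] //= ; rewrite num_paths_Kbip_gt0 //.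
  have := uphalf_half h.+1; have := odd_double_half h.+1.
  by rewrite /L; case: eqP; lia.
apply: (@leq_bigmax_cond _ _ _ (Ordinal L_lt)) => /=.
rewrite num_paths_Kbip_gt0 //.
have := uphalf_half L; have := odd_double_half L.
by rewrite {3 4}/L; case: eqP; lia.
Qed.

(** * The closed formula over the rationals *)

Local Open Scope ring_scope.

(** Truncation in [n - m] is harmless: it occurs only for [n < m], where [n ^_ m] is already 0. *)
Lemma natr_ffact (R : pzRingType) (n m : nat) :
  (n ^_ m)%:R = \prod_(0 <= i < m) (n%:R - i%:R) :> R.
Proof.
elim: m => [|m IH]; first by rewrite big_geq.
rewrite big_nat_recr //= -IH ffactnSr natrM.
have [le_mn|lt_nm] := leqP m n; first by rewrite natrB.
by rewrite ffact_small // !mul0r.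
Qed.

Lemma num_paths_Kbip (n1 n2 h : nat) : (0 < h)%N ->
  (num_paths (Kbip n1 n2) h)%:R =
  (if odd h then
     \prod_(0 <= i < ((h - 1) %/ 2).+1) ((n1%:R - i%:R) * (n2%:R - i%:R))
   else
     1 / 2 * (\prod_(0 <= i < h %/ 2) ((n1%:R - i%:R) * (n2%:R - i%:R)))
           * ((n1%:R - h%:R / 2) + (n2%:R - h%:R / 2))) :> rat.
Proof.
move=> h_gt0.
have := congr1 (fun m => m%:R : rat) (two_num_paths_Kbip n1 n2 h h_gt0).
rewrite natrM natrD (natrM _ (n1 ^_ _)) (natrM _ (n2 ^_ _)) !natr_ffact !big_split /= => E.
apply: (@mulfI _ (2%:R : rat)) => //; rewrite {}E.
rewrite !divn2 uphalf_half; case: ifP => odd_h.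
  (* For odd [h], [uphalf h = h./2.+1], so the two summands coincide and absorb the factor 2. *)
  have -> : (h - 1)./2 = h./2 by lia.
  by rewrite add1n; ring.
(* For even [h], [uphalf h = h./2]; splitting off the last factor of the longer product leaves
   [n1 - h / 2] in one summand and [n2 - h / 2] in the other. *)
have -> : h%:R = 2 * h./2%:R :> rat by rewrite -natrM; congr _%:R; lia.
by rewrite add0n !big_nat_recr //=; field.
Qed.

Theorem theorem3 (n1 n2 : nat) (hn1 : (1 <= n1)%N) (hn12 : (n1 <= n2)%N) :
  longest_path (Kbip n1 n2)
    = (if n1 == n2 then (2 * n1 - 1)%N else (2 * n1)%N)
  /\ forall h : nat, (1 <= h <= longest_path (Kbip n1 n2))%N ->
     (num_paths (Kbip n1 n2) h)%:R =
       (if odd h then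
          \prod_(0 <= i < ((h - 1) %/ 2).+1)
             ((n1%:R - i%:R) * (n2%:R - i%:R))
        else
          1 / 2 * (\prod_(0 <= i < h %/ 2)
                      ((n1%:R - i%:R) * (n2%:R - i%:R)))
                * ((n1%:R - h%:R / 2) + (n2%:R - h%:R / 2))) :> rat.
Proof.
split; first exact: longest_path_Kbip.
by move=> h /andP[h_gt0 _]; exact: num_paths_Kbip.
Qed.
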